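(* For each integer $d\ge 1$, there exists a reduced linking system of difference sets in $\mathbb{Z}_2^{2d+2}$ of size $2^{2d+1}-1$, that is, a reduced $\left(2^{2d+2},\,2^d(2^{d+1}-1),\,2^d(2^d-1),\,2^{2d};\,2^{2d+1}-1\right)$-linking system of difference sets in $\mathbb{Z}_2^{2d+2}$.
   Context: Groups are written multiplicatively. For a group $G$ of order $v$, a subset $D\subseteq G$ with $k$ elements is a $(v,k,\lambda,n)$-difference set in $G$ if the multiset $\{d_1d_2^{-1} : d_1,d_2\in D,\ d_1\neq d_2\}$ contains every non-identity element of $G$ exactly $\lambda$ times, where $n:=k-\lambda$. A subset $S$ of $G$ is identified with the element $\sum_{s\in S}s$ of the group ring $\mathbb{Z}[G]$, and $S^{(-1)}:=\sum_{s\in S}s^{-1}$. For $\ell\ge 2$, a collection $\{D_1,\dots,D_\ell\}$ of size $\ell$ of $(v,k,\lambda,n)$-difference sets in $G$ is a reduced $(v,k,\lambda,n;\ell)$-linking system of difference sets in $G$ of size $\ell$ if there are integers $\mu,\nu$ such that for all distinct $i,j$ there is some $(v,k,\lambda,n)$-difference set $D(i,j)$ in $G$ (not necessarily one of the $D_r$) with $D_iD_j^{(-1)}=(\mu-\nu)D(i,j)+\nu G$ in $\mathbb{Z}[G]$. *)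

(* Defs.v *)
From HB Require Import structures.
From mathcomp Require Import all_boot all_order all_algebra all_fingroup.

Set Implicit Arguments.
Unset Strict Implicit.
Unset Printing Implicit Defensive.

Import GRing.Theory.
Local Open Scope ring_scope.

(* Elements of Z[G] are coefficient functions; an alias of the finfun type is
   needed because the product is convolution, not the pointwise product. *)
Definition group_algebra (gT : finGroupType) : Type := {ffun gT -> int}.

Section GroupAlgebra.
Variable gT : finGroupType.

HB.instance Definition _ :=
  GRing.Zmodule.copy (group_algebra gT) {ffun gT -> int}.

Definition ga_elt (g : gT) : group_algebra gT := [ffun x => (x == g)%:Z].

Definition ga_mul (a b : group_algebra gT) : group_algebra gT :=
  [ffun g => \sum_(h : gT) a h * b (h^-1 * g)%g].

Lemma ga_addE (a b : group_algebra gT) g : (a + b) g = a g + b g.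
Proof. exact: ffunE. Qed.

Lemma ga_mulA : associative ga_mul.
Proof.
move=> a b c; apply/ffunP=> g; rewrite !ffunE.
under eq_bigr => h _.
  rewrite ffunE mulr_sumr (reindex_inj (mulgI h^-1%g)).
  over.
rewrite exchange_big; apply: eq_bigr => t _ /=; rewrite ffunE mulr_suml.
by apply: eq_bigr => h _; rewrite invMg invgK mulgA mulgK mulrA.
Qed.

Lemma ga_mul1l : left_id (ga_elt 1) ga_mul.
Proof.
move=> a; apply/ffunP=> g; rewrite ffunE (bigD1 1%g) //= ffunE eqxx invg1 mul1g.
rewrite mul1r big1 ?addr0 // => h /negPf h1; by rewrite ffunE h1 mul0r.
Qed.

Lemma ga_mul1r : right_id (ga_elt 1) ga_mul.
Proof.
move=> a; apply/ffunP=> g; rewrite ffunE (bigD1 g) //= ffunE mulVg eqxx mulr1.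
rewrite big1 ?addr0 // => h hg; rewrite ffunE -eq_mulVg1 (negPf hg) mulr0 //.
Qed.

Lemma ga_mulDl : left_distributive ga_mul +%R.
Proof.
move=> a b c; apply/ffunP=> g; rewrite ga_addE !ffunE -big_split.
by apply: eq_bigr => h _; rewrite ga_addE mulrDl.
Qed.

Lemma ga_mulDr : right_distributive ga_mul +%R.
Proof.
move=> a b c; apply/ffunP=> g; rewrite ga_addE !ffunE -big_split.
by apply: eq_bigr => h _; rewrite ga_addE mulrDr.
Qed.

Lemma ga_oner_neq0 : ga_elt 1 != 0.
Proof. by apply/eqP => /ffunP/(_ 1%g); rewrite !ffunE eqxx. Qed.

HB.instance Definition _ := GRing.Zmodule_isNzRing.Build (group_algebra gT)
  ga_mulA ga_mul1l ga_mul1r ga_mulDl ga_mulDr ga_oner_neq0.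

Definition ga_set (S : {set gT}) : group_algebra gT := \sum_(s in S) ga_elt s.

Definition ga_setV (S : {set gT}) : group_algebra gT :=
  \sum_(s in S) ga_elt s^-1%g.

Definition difference_set (v k lambda n : nat) (D : {set gT}) : Prop :=
  [/\ #|gT| = v,
      #|D| = k,
      n%:Z = k%:Z - lambda%:Z
    & forall g : gT, g != 1%g ->
        #|[set p : gT * gT | [&& p.1 \in D, p.2 \in D, p.1 != p.2
                               & (p.1 * p.2^-1)%g == g]]| = lambda].

Definition reduced_linking_system (v k lambda n l : nat)
    (D : 'I_l -> {set gT}) : Prop :=
  [/\ (2 <= l)%N,
      injective D,
      forall i : 'I_l, difference_set v k lambda n (D i)
    & exists mu nu : int, forall i j : 'I_l, i != j ->
        exists Dij : {set gT}, difference_set v k lambda n Dij /\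
          ga_set (D i) * ga_setV (D j)
            = ga_set Dij *~ (mu - nu) + ga_set [set: gT] *~ nu].

End GroupAlgebra.

(* Main.v *)
From HB Require Import structures.
Require Import Defs.
From mathcomp Require Import all_boot all_order all_algebra all_fingroup.
From mathcomp Require Import all_solvable finfield ring zify.

(** The construction is the Fourier-dual form of the Kerdock set of quadratic
    forms.

    Write V for the vector space of dimension m = 2d + 2 over the field with
    two elements.  A Boolean function f on V is bent when all its Walsh
    coefficients W_f(x), the sums over y of (-1)^(f(y) + x.y), have absolute
    value 2^(d+1).  For such an f with f(0) = 0 let D_f be the set of points
    where W_f is negative; its indicator is an affine function of W_f.  The
    Walsh transform turns pointwise sums into convolutions,
    W_f * W_g = 2^m W_(f+g), so that the correlation of D_f and D_g is an
    affine function of W_(f+g) (lemma [corr_negset]).  With g = f, where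
    W_(f+g) is supported at 0, this says that D_f is a difference set.  With
    f + g bent it says that the product of D_f and the inverse of D_g is a
    combination of D_(f+g) and V.  Hence a family of bent functions vanishing
    at 0, all of whose pairwise sums are bent, yields a linking system of the
    same size ([linking_system_of_bent]).

    A quadratic form with nondegenerate polar form is bent ([bent_polar]), so
    it remains to find 2^(2d+1) - 1 nonzero quadratic forms which, with 0
    added, have pairwise nondegenerate differences.  Let n = 2d + 1, let F be
    the field with 2^n elements, and identify V with the sum of F and the
    prime field.  For a in F put
      Q_a(x, s) = e(ax) + s Tr(ax),
    where e(u) is the second elementary symmetric function of the conjugates
    of u.  The polar form of e is Tr(u)Tr(v) + Tr(uv), so a vector (x, s) in
    the radical of Q_a + Q_b, with a and b distinct, satisfies
    Tr(ax) = Tr(bx) and (a + b)x = Tr(ax) + s.  The right-hand side lies in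
    the prime field and the left-hand side has trace 0; since n is odd,
    Tr(1) = 1, so both sides vanish and (x, s) = 0
    ([kerdock_polar_nondegenerate]). *)

Set Implicit Arguments.
Unset Strict Implicit.
Unset Printing Implicit Defensive.
Import Order.TTheory GRing.Theory Num.Theory.
Local Open Scope ring_scope.

(** * Walsh transform and bent functions *)

(** Orthogonality of characters: translating by a point where the character is
    -1 changes the sign of its sum. *)
Lemma sum_sign_additive (V : finZmodType) (b : V -> bool) (y0 : V) :
  {morph b : x y / x + y >-> x (+) y} -> b y0 ->
  \sum_y (-1) ^+ b y = 0 :> int.
Proof.
move=> bD by0; set S := (X in X = _).
suff : S = - S by lia.
rewrite {1}/S (reindex_inj (addrI y0)) -sumrN /=; apply: eq_bigr => y _.
by rewrite bD by0 signrN.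
Qed.

Lemma neq0_add_Z2 (s t : 'Z_2) : (s + t != 0) = (s != 0) (+) (t != 0).
Proof. by case: s t => [[|[|s]] ?] // [[|[|t]] ?]. Qed.

Lemma oppr_Z2 m (x : 'rV['Z_2]_m) : - x = x.
Proof.
apply/rowP=> i; rewrite mxE.
by case: (x 0 i) => [[|[|s]] ?] //; apply/val_inj.
Qed.

Lemma addrr_Z2 m (x : 'rV['Z_2]_m) : x + x = 0.
Proof. by rewrite -{2}(oppr_Z2 x) subrr. Qed.

Section Walsh.
Variable m : nat.
Notation V := 'rV['Z_2]_m.

Lemma card_rV_Z2 : #|{: V}| = (2 ^ m)%N.
Proof. by rewrite card_mx mul1n card_ord. Qed.

Definition dot (x y : V) : bool := (x *m y^T) 0 0 != 0.

Lemma dotDl x x' y : dot (x + x') y = dot x y (+) dot x' y.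
Proof. by rewrite /dot mulmxDl mxE neq0_add_Z2. Qed.

Lemma dotC x y : dot x y = dot y x.
Proof. by rewrite /dot -[x *m _]trmxK trmx_mul trmxK mxE. Qed.

Lemma dotDr x y y' : dot x (y + y') = dot x y (+) dot x y'.
Proof. by rewrite !(dotC x) dotDl. Qed.

Lemma dot_nondegenerate x : x != 0 -> exists y, dot x y.
Proof.
move=> /rV0Pn[i xi]; exists (delta_mx 0 i).
by rewrite /dot trmx_delta -colE mxE.
Qed.

Lemma sum_sign_dot x : \sum_y (-1) ^+ dot x y = (2 ^ m)%N%:Z * (x == 0)%:R.
Proof.
have [->|/dot_nondegenerate[y xy]] := eqVneq x 0.
  under eq_bigr do rewrite /dot mul0mx mxE eqxx.
  by rewrite sumr_const card_rV_Z2 mulr1 natz.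
by rewrite mulr0 (sum_sign_additive (dotDr x) xy).
Qed.

Definition walsh (f : V -> bool) (x : V) : int :=
  \sum_y (-1) ^+ (f y (+) dot x y).

Definition addf (f g : V -> bool) (x : V) := f x (+) g x.

Lemma sum_walsh f : \sum_x walsh f x = (2 ^ m)%N%:Z * (-1) ^+ f 0.
Proof.
rewrite /walsh exchange_big (bigD1 0) //= [X in _ + X]big1 => [|y y0].
- under eq_bigr => x _ do rewrite signr_addb dotC.
  by rewrite -mulr_sumr sum_sign_dot eqxx mulr1 addr0 mulrC.
- under eq_bigr => x _ do rewrite signr_addb dotC.
  by rewrite -mulr_sumr sum_sign_dot (negPf y0) !mulr0.
Qed.

(** The convolution theorem.  Expanding both transforms, the sum over h of
    (-1)^((y + z).h) leaves only the terms with y = z. *)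
Lemma walsh_conv f g x :
  \sum_h walsh f h * walsh g (h + x) = (2 ^ m)%N%:Z * walsh (addf f g) x.
Proof.
transitivity (\sum_y \sum_z (-1) ^+ (f y (+) g z (+) dot x z)
                * \sum_h (-1) ^+ dot (y + z) h : int).
  under eq_bigr => h _.
    rewrite /walsh mulr_suml; under eq_bigr do rewrite mulr_sumr; over.
  rewrite exchange_big; apply: eq_bigr => y _; rewrite exchange_big /=.
  apply: eq_bigr => z _; rewrite mulr_sumr; apply: eq_bigr => h _.
  rewrite -!signr_addb !dotDl (dotC y) (dotC z).
  congr (_ ^+ _); congr nat_of_bool.
  by case: (f y) (g z) (dot x z) (dot h y) (dot h z) => [] [] [] [] [].
rewrite mulr_sumr; apply: eq_bigr => y _.
rewrite (bigD1 y) //= [X in _ + X]big1 => [|z zy]; rewrite sum_sign_dot.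
  by rewrite addrr_Z2 eqxx mulr1 addr0 mulrC -addbA.
by rewrite -(oppr_Z2 z) subr_eq0 eq_sym (negPf zy) !mulr0.
Qed.

(** By Parseval this is the flattest possible spectrum; squares avoid a square
    root of 2 ^ m when m is odd. *)
Definition bent f := forall x, walsh f x ^+ 2 = (2 ^ m)%N%:Z.

(** Squaring the Walsh coefficient and writing one summation variable as y + z
    makes the sum over y that of the character B z, which vanishes unless z = 0
    because B is nondegenerate. *)
Lemma bent_polar f (B : V -> V -> bool) :
  (forall x y, f (x + y) = f x (+) f y (+) B x y) ->
  (forall x, {morph B x : y z / y + z >-> y (+) z}) ->
  (forall x, (forall y, B x y = false) -> x = 0) -> bent f.
Proof.
move=> fB BD Bnd x; rewrite expr2 {1}/walsh mulr_suml.
transitivity (\sum_z (-1) ^+ (f z (+) dot x z) * \sum_y (-1) ^+ B z y : int).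
  under [RHS]eq_bigr do rewrite mulr_sumr.
  rewrite [RHS]exchange_big; apply: eq_bigr => y _ /=.
  rewrite mulr_sumr (reindex_inj (addIr y)); apply: eq_bigr => z _.
  rewrite -!signr_addb fB dotDr; congr (_ ^+ _); congr nat_of_bool.
  by case: (f y) (f z) (B z y) (dot x z) (dot x y) => [] [] [] [] [].
(* Additivity gives B 0 0 = 0; evaluating f at 0 + y then gives f 0 = B 0 y. *)
have B0 y : B 0 y = false.
  have := fB 0 y; rewrite add0r; have := fB 0 0; rewrite add0r.
  have := BD 0 0 0; rewrite addr0.
  by case: (B 0 0) (f 0) (f y) (B 0 y) => [] [] [] [].
rewrite (bigD1 0) //= [X in _ + X]big1 ?addr0 => [|z z0].
  under eq_bigr do rewrite B0.
  rewrite sumr_const card_rV_Z2.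
  have -> : f 0 = false by have := fB 0 0; rewrite addr0 B0; case: (f 0).
  by rewrite /dot trmx0 mulmx0 mxE eqxx mul1r natz.
have [y Bzy] : exists y, B z y.
  case: (pickP (B z)) => [y|] Bz; first by exists y.
  by rewrite (Bnd z Bz) eqxx in z0.
by rewrite (sum_sign_additive (BD z) Bzy) mulr0.
Qed.

(** * Difference sets from bent functions *)

(** The support of the bent function dual to [f]. *)
Definition negset f := [set x | walsh f x < 0].

Definition corr (A B : {set V}) x : int :=
  \sum_h (h \in A)%:R * (h + x \in B)%:R.

Section Dim.
Variables (d : nat) (m_eq : m = (2 * d + 2)%N).

Lemma pow2mE : (2 ^ m)%N%:Z = 4 * (2 ^+ d) ^+ 2.
Proof. by rewrite m_eq -natz natrX exprD mulnC exprM mulrC. Qed.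

Lemma walsh_bentE f x : bent f ->
  walsh f x = 2 * 2 ^+ d * (1 - 2 * (x \in negset f)%:R).
Proof.
move=> /(_ x); rewrite pow2mE inE.
have : 0 < 2 ^+ d :> int by rewrite exprn_gt0.
move: (walsh f x) (2 ^+ d : int) => w t t0 wt.
have : (w - 2 * t) * (w + 2 * t) = 0 by rewrite -subr_sqr wt; ring.
move=> /eqP; rewrite mulf_eq0 => /orP[] /eqP wE.
- have {wE wt} -> : w = 2 * t by lia.
  by rewrite ltNge (_ : 0 <= _) /=; lia.
- have {wE wt} -> : w = - (2 * t) by lia.
  by rewrite (_ : _ < 0) /=; lia.
Qed.

(** Twice the indicator of the negative set is 1 - W / 2 ^ (d + 1), so the
    correlation expands into the total sums of W f and W g, which are 2 ^ m as
    f and g vanish at 0, and their convolution. *)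
Lemma corr_negset f g x : bent f -> bent g -> f 0 = false -> g 0 = false ->
  4 * corr (negset f) (negset g) x
    = 4 * (2 ^+ d) ^+ 2 - 4 * 2 ^+ d + walsh (addf f g) x.
Proof.
move=> bf bg f0 g0.
(* The identity is proved after multiplication by 2 ^ m, which clears the
   denominators of the indicators. *)
have t0 : 2 ^+ d != 0 :> int by rewrite expf_neq0.
apply: (@mulfI _ (4 * (2 ^+ d) ^+ 2)); first by rewrite mulf_neq0 ?expf_neq0.
have swf : \sum_h walsh f h = 4 * (2 ^+ d) ^+ 2.
  by rewrite sum_walsh f0 mulr1 pow2mE.
have swg : \sum_h walsh g (h + x) = 4 * (2 ^+ d) ^+ 2.
  transitivity (\sum_h walsh g h).
    by rewrite [RHS](reindex_inj (addIr x)).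
  by rewrite sum_walsh g0 mulr1 pow2mE.
have := walsh_conv f g x; rewrite pow2mE => swfg.
have sc : \sum_(h : V) ((2 * 2 ^+ d) ^+ 2 : int) = (4 * (2 ^+ d) ^+ 2) ^+ 2.
  rewrite sumr_const card_rV_Z2 -[LHS]mulr_natr (natz (2 ^ m)%N).
  by rewrite pow2mE; ring.
transitivity (\sum_h (2 * 2 ^+ d - walsh f h) * (2 * 2 ^+ d - walsh g (h + x))).
  rewrite !mulr_sumr; apply: eq_bigr => h _.
  by rewrite (walsh_bentE h bf) (walsh_bentE (h + x) bg); ring.
transitivity (\sum_(h : V) (2 * 2 ^+ d) ^+ 2
   - 2 * 2 ^+ d * \sum_h walsh f h - 2 * 2 ^+ d * \sum_h walsh g (h + x)
   + \sum_h walsh f h * walsh g (h + x)).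
  rewrite !mulr_sumr -!sumrB -big_split /=; apply: eq_bigr => h _; ring.
by rewrite sc swf swg swfg; ring.
Qed.

Lemma walsh_addff f x :
  walsh (addf f f) x = 4 * (2 ^+ d) ^+ 2 * (x == 0)%:R.
Proof.
rewrite -pow2mE -sum_sign_dot; apply: eq_bigr => y _.
by rewrite /addf addbb.
Qed.

Lemma corr0 (A : {set V}) : corr A A 0 = #|A|%:Z.
Proof.
rewrite /corr -sum1_card -natz natr_sum [RHS]big_mkcond.
apply: eq_bigr => h _ /=.
by rewrite addr0; case: (h \in A).
Qed.

Lemma corr_pairs (A : {set V}) g : g != 0 ->
  corr A A g = #|[set p : V * V | [&& p.1 \in A, p.2 \in A, p.1 != p.2
                               & (p.1 * p.2^-1)%g == g]]|%:Z.
Proof.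
move=> g0.
(* A pair is determined by its first entry: q = p + g in characteristic 2. *)
have -> : [set p : V * V | [&& p.1 \in A, p.2 \in A, p.1 != p.2
                               & (p.1 * p.2^-1)%g == g]]
  = [set (h, h + g) | h in [set h | (h \in A) && (h + g \in A)]].
  apply/setP=> -[p q]; rewrite inE /=; apply/and4P/imsetP.
  - case=> pA qA pq /eqP gE.
    have qE : p + g = q.
      rewrite -gE FinRing.zmodMgE FinRing.zmodVgE.
      by rewrite oppr_Z2 addrA addrr_Z2 add0r.
    by exists p; rewrite ?inE ?pA qE.
  - case=> h; rewrite inE => /andP[hA hgA] [-> ->]; split=> //.
      by rewrite -subr_eq0 opprD addNKr oppr_eq0.
    rewrite FinRing.zmodMgE FinRing.zmodVgE.
    by rewrite oppr_Z2 addrA addrr_Z2 add0r.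
rewrite card_imset => [|p q [] //].
rewrite /corr -sum1_card -natz natr_sum [RHS]big_mkcond.
apply: eq_bigr => h _ /=.
by rewrite inE; case: (h \in A) (h + g \in A) => [] [].
Qed.

(** The autocorrelation of the set is its size at 0, and elsewhere counts the
    ways of writing a point as a difference; the Walsh transform of f + f = 0
    being supported at 0, [corr_negset] evaluates both. *)
Lemma difference_set_negset f : bent f -> f 0 = false ->
  difference_set (2 ^ (2 * d + 2)) (2 ^ d * (2 ^ (d + 1) - 1))
      (2 ^ d * (2 ^ d - 1)) (2 ^ (2 * d)) (negset f).
Proof.
move=> bf f0.
have P x : 4 * corr (negset f) (negset f) x
    = 4 * (2 ^+ d) ^+ 2 - 4 * 2 ^+ d + 4 * (2 ^+ d) ^+ 2 * (x == 0)%:R.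
  by rewrite corr_negset // walsh_addff.
have t1 : (0 < 2 ^ d)%N by rewrite expn_gt0.
have tE : (2 ^ d)%N%:Z = 2 ^+ d by rewrite -natz natrX.
split.
- by rewrite card_rV_Z2 m_eq.
- move: (P 0); rewrite corr0 eqxx mulr1 -tE addn1 expnS.
  case: (2 ^ d)%N t1 => // k _; move: #|_| => c; rewrite expr2.
  by rewrite (_ : 2 * k.+1 - 1 = 2 * k + 1)%N; lia.
- rewrite addn1 expnS mul2n -addnn expnD; case: (2 ^ d)%N t1 => // k _.
  by rewrite (_ : 2 * k.+1 - 1 = 2 * k + 1)%N ?subn1 /=; lia.
- move=> g g1; have g0 : g != 0 by [].
  move: (P g); rewrite corr_pairs // (negPf g0) mulr0 addr0 -tE.
  by case: (2 ^ d)%N t1 => // k _; move: #|_| => c; rewrite subn1 expr2 /=; lia.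
Qed.

Lemma ga_setE (gT : finGroupType) (A : {set gT}) x : ga_set A x = (x \in A)%:R.
Proof.
rewrite /ga_set sum_ffunE.
under eq_bigr do rewrite ffunE.
rewrite big_mkcond (bigD1 x) //= big1 => [|y yx].
  by rewrite eqxx addr0; case: ifP.
by rewrite eq_sym (negPf yx) if_same.
Qed.

Lemma ga_setVE (gT : finGroupType) (A : {set gT}) x :
  ga_setV A x = (x^-1%g \in A)%:R.
Proof.
rewrite /ga_setV sum_ffunE.
under eq_bigr do rewrite ffunE.
rewrite big_mkcond (bigD1 x^-1%g) //= big1 => [|y yx].
  by rewrite invgK eqxx addr0; case: ifP.
by rewrite -(inv_eq (@invgK gT)) eq_sym (negPf yx) if_same.
Qed.

Lemma ga_mul_corr (A B : {set V}) x : (ga_set A * ga_setV B) x = corr A B x.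
Proof.
rewrite /GRing.mul /= ffunE; apply: eq_bigr => h _.
rewrite ga_setE ga_setVE invMg invgK !FinRing.zmodMgE FinRing.zmodVgE.
by rewrite oppr_Z2 addrC.
Qed.

Lemma ga_mulz (gT : finGroupType) (a : group_algebra gT) (z : int) x :
  (a *~ z) x = a x * z.
Proof.
suff E n : (a *+ n) x = a x *+ n.
  case: z => n; first by rewrite -!pmulrn E -mulr_natr natz.
  by rewrite !NegzE !mulrNz -!pmulrn ffunE E mulrN -mulr_natr natz.
by elim: n => [|n IHn]; rewrite ?mulr0n ?ffunE // !mulrS ga_addE IHn.
Qed.

(** The parameters nu = 2 ^ (2d) - 2 ^ (d-1) and mu = nu - 2 ^ d are read off
    from [corr_negset]; nu is an integer because d is positive.  Injectivity
    comes from the same formula: if f i and f j had the same negative set, the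
    Walsh coefficient of f i + f j at 0 would be 2 ^ m, too large for a bent
    function. *)
Theorem linking_system_of_bent l (f : 'I_l -> V -> bool) : (1 <= d)%N ->
  (2 <= l)%N -> (forall i, f i 0 = false) -> (forall i, bent (f i)) ->
  (forall i j, i != j -> bent (addf (f i) (f j))) ->
  reduced_linking_system (2 ^ (2 * d + 2)) (2 ^ d * (2 ^ (d + 1) - 1))
      (2 ^ d * (2 ^ d - 1)) (2 ^ (2 * d)) (fun i => negset (f i)).
Proof.
move=> d1 l2 f0 bf bff.
set t : int := 2 ^+ d.
have t_gt0 : 0 < t by rewrite exprn_gt0.
have tE : t = 2 * 2 ^+ d.-1 by rewrite -exprS prednK.
pose nu := t ^+ 2 - 2 ^+ d.-1.
split=> // [i j ij|i|].
- apply/eqP/negPn/negP=> nij; have := corr_negset 0 (bf i) (bf j) (f0 i) (f0 j).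
  rewrite -ij corr_negset // walsh_addff eqxx (walsh_bentE 0 (bff _ _ nij)).
  by rewrite -/t; case: (_ \in _) => /=; nia.
- exact: difference_set_negset.
exists (nu - t), nu => i j nij.
exists (negset (addf (f i) (f j))); split.
  by apply: difference_set_negset (bff _ _ nij) _; rewrite /addf !f0.
apply/ffunP=> x; rewrite ga_mul_corr ga_addE !ga_mulz !ga_setE in_setT.
have := corr_negset x (bf i) (bf j) (f0 i) (f0 j).
rewrite (walsh_bentE x (bff _ _ nij)) -/t /nu.
by case: (_ \in _) => /=; lia.
Qed.

End Dim.
End Walsh.

(** * The Kerdock family of quadratic forms *)

(** The second elementary symmetric function of u 0, ..., u (k-1). *)
Definition esym2 (R : comNzRingType) (u : nat -> R) k :=
  \sum_(j < k) (\sum_(i < j) u i) * u j.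

Lemma esym2D (R : comNzRingType) (u v : nat -> R) k :
  esym2 (fun i => u i + v i) k = esym2 u k + esym2 v k
    + ((\sum_(i < k) u i) * (\sum_(i < k) v i) - \sum_(i < k) u i * v i).
Proof.
rewrite /esym2; elim: k => [|k IHk]; first by rewrite !big_ord0; ring.
by rewrite !(big_ord_recr k) /= {}IHk big_split /=; ring.
Qed.

(** Invariance under a cyclic shift: both sides arise from the k + 1 terms
    u 0, ..., u k by dropping one of the two equal end terms. *)
Lemma esym2_shift (R : comNzRingType) (u : nat -> R) k : u k = u 0%N ->
  esym2 (fun i => u i.+1) k = esym2 u k.
Proof.
move=> uk0.
have S j : \sum_(i < j.+1) u i = u 0%N + \sum_(i < j) u i.+1.
  by rewrite big_ord_recl.
have E : esym2 u k.+1 =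
    esym2 (fun i => u i.+1) k + u 0%N * \sum_(i < k) u i.+1.
  rewrite /esym2 big_ord_recl big_ord0 mul0r add0r mulr_sumr -big_split /=.
  by apply: eq_bigr => j _; rewrite S; ring.
have := E; rewrite {1}/esym2 big_ord_recr /= -/(esym2 u k) uk0.
have -> : \sum_(i < k) u i = \sum_(i < k) u i.+1.
  by apply: (addrI (u 0%N)); rewrite -S big_ord_recr /= uk0 addrC.
by rewrite mulrC => /addIr.
Qed.

(** An alias of the product type, so that its additive group can be regarded as
    a finite group in multiplicative notation without competing with the direct
    product of the groups of the two factors. *)
Definition kerdock_space (F : finFieldType) : Type := (F * 'Z_2)%type.

HB.instance Definition _ (F : finFieldType) :=
  GRing.Zmodule.copy (kerdock_space F) (F * 'Z_2)%type.
HB.instance Definition _ (F : finFieldType) :=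
  Finite.copy (kerdock_space F) (F * 'Z_2)%type.

Section Kerdock.
Variables (F : finFieldType) (n : nat).
Hypotheses (F2 : 2%N \in [pchar F]) (cardF : #|F| = (2 ^ n)%N) (n_odd : odd n).

Lemma frobD k (x y : F) : (x + y) ^+ (2 ^ k) = x ^+ (2 ^ k) + y ^+ (2 ^ k).
Proof. by rewrite exprDn_pchar // pnatX (pnatE _ _) // F2. Qed.

Lemma sqr_sum (I : Type) (r : seq I) (G : I -> F) :
  (\sum_(i <- r) G i) ^+ 2 = \sum_(i <- r) G i ^+ 2.
Proof.
by apply: (big_morph (fun x => x ^+ 2)) => [x y|]; rewrite ?(frobD 1) ?expr0n.
Qed.

Definition Tr (x : F) := \sum_(i < n) x ^+ (2 ^ i).
(** A characteristic-2 substitute for one half of (Tr x)^2 - Tr (x^2). *)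
Definition Q2 (x : F) := esym2 (fun i => x ^+ (2 ^ i)) n.

Lemma conjS (x : F) i : (x ^+ (2 ^ i)) ^+ 2 = x ^+ (2 ^ i.+1).
Proof. by rewrite -exprM expnSr. Qed.

Lemma conj_n (x : F) : x ^+ (2 ^ n) = x ^+ (2 ^ 0).
Proof. by rewrite -cardF expf_card. Qed.

Lemma TrD x y : Tr (x + y) = Tr x + Tr y.
Proof. by rewrite -big_split /=; apply: eq_bigr => i _; rewrite frobD. Qed.

Lemma Tr_sqr x : Tr (x ^+ 2) = Tr x.
Proof.
rewrite /Tr; apply: (addrI (x ^+ (2 ^ 0))); rewrite -{2}conj_n addrC.
rewrite [RHS]addrC -(big_ord_recr n (fun i => x ^+ (2 ^ i))).
rewrite big_ord_recl /= addrC.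
by congr (_ + _); apply: eq_bigr => i _; rewrite -exprM expnS.
Qed.

Lemma sqr_Tr x : Tr x ^+ 2 = Tr x.
Proof.
rewrite -[RHS]Tr_sqr /Tr sqr_sum; apply: eq_bigr => i _.
by rewrite -!exprM mulnC.
Qed.

Lemma Tr1 : Tr 1 = 1.
Proof.
rewrite /Tr; under eq_bigr do rewrite expr1n.
rewrite sumr_const card_ord -(odd_double_half n) n_odd -muln2 mulrnDr.
by rewrite mulnC mulrnA (pcharf0 F2) mul0rn addr0.
Qed.

(** The Frobenius map permutes the conjugates cyclically, so it fixes their
    symmetric functions. *)
Lemma sqr_Q2 x : Q2 x ^+ 2 = Q2 x.
Proof.
rewrite -[RHS]esym2_shift ?conj_n // /Q2 /esym2 sqr_sum.
apply: eq_bigr => j _; rewrite exprMn sqr_sum conjS; congr (_ * _).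
by apply: eq_bigr => i _; rewrite conjS.
Qed.

Lemma Q2D x y : Q2 (x + y) = Q2 x + Q2 y + (Tr x * Tr y + Tr (x * y)).
Proof.
rewrite -(oppr_pchar2 F2 (Tr (x * y))).
transitivity (esym2 (fun i => x ^+ (2 ^ i) + y ^+ (2 ^ i)) n).
  apply: eq_bigr => j _; rewrite frobD; congr (_ * _).
  by apply: eq_bigr => i _; rewrite frobD.
rewrite esym2D; congr (_ + (_ - _)).
by apply: eq_bigr => i _; rewrite exprMn.
Qed.

Lemma idem01 (z : F) : z ^+ 2 = z -> z = (z != 0)%:R.
Proof.
move=> zz; have [-> //|z0] := eqVneq z 0.
by apply: (mulfI z0); rewrite mulr1 -expr2 zz.
Qed.

Lemma neq0_addb (b c : bool) : (b%:R + c%:R != 0 :> F) = b (+) c.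
Proof.
case: b c => [] [] //=; rewrite ?addr0 ?add0r ?oner_eq0 ?eqxx //.
by rewrite (addrr_pchar2 F2) eqxx.
Qed.

(** Trace and [Q2] take values 0 and 1 in F; the Boolean versions are the ones
    that enter the signs of a Walsh sum. *)
Definition tr x := Tr x != 0.
Definition q2 x := Q2 x != 0.

Lemma trE x : Tr x = (tr x)%:R. Proof. exact/idem01/sqr_Tr. Qed.
Lemma q2E x : Q2 x = (q2 x)%:R. Proof. exact/idem01/sqr_Q2. Qed.

Lemma trD x y : tr (x + y) = tr x (+) tr y.
Proof. by rewrite {1}/tr TrD !trE neq0_addb. Qed.

Lemma tr0 : tr 0 = false.
Proof. by have := trD 0 0; rewrite addr0 addbb. Qed.

Lemma tr1 : tr 1.
Proof. by rewrite /tr Tr1 oner_eq0. Qed.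

Lemma q2D x y : q2 (x + y) = q2 x (+) q2 y (+) ((tr x && tr y) (+) tr (x * y)).
Proof.
rewrite {1}/q2 Q2D !trE !q2E -natrM mulnb.
have E (b c : bool) : b%:R + c%:R = (b (+) c)%:R :> F.
  by case: b c => [] [] //=; rewrite ?addr0 ?add0r ?(addrr_pchar2 F2).
by rewrite !E; case: (_ (+) _); rewrite ?oner_eq0 ?eqxx.
Qed.

Lemma tr_nondegenerate c : (forall y, tr (c * y) = false) -> c = 0.
Proof.
move=> cN; apply/eqP/negPn/negP => c0.
by have := cN c^-1; rewrite mulfV // tr1.
Qed.

Definition kerdock_form (a : F) (w : kerdock_space F) :=
  q2 (a * w.1) (+) ((w.2 != 0) && tr (a * w.1)).

Definition kerdock_polar a (w z : kerdock_space F) :=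
  (tr (a * w.1) && tr (a * z.1)) (+) tr (a * w.1 * (a * z.1))
  (+) ((w.2 != 0) && tr (a * z.1)) (+) ((z.2 != 0) && tr (a * w.1)).

Lemma kerdock_formD a w z :
  kerdock_form a (w + z) =
    kerdock_form a w (+) kerdock_form a z (+) kerdock_polar a w z.
Proof.
case: w z => [x s] [y t]; rewrite /kerdock_form /kerdock_polar /=.
rewrite mulrDr q2D trD neq0_add_Z2.
move: (tr (a * x)) (tr (a * y)) (tr (a * x * _)) (q2 _) (q2 _).
move: (s != 0) (t != 0).
by do 7! case.
Qed.

Lemma kerdock_polarD a w : {morph kerdock_polar a w : y z / y + z >-> y (+) z}.
Proof.
case: w => [x s] [y t] [y' t']; rewrite /kerdock_polar /=.
rewrite !mulrDr !trD neq0_add_Z2.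
move: (tr (a * x)) (tr (a * y)) (tr (a * y')) (s != 0) (t != 0) (t' != 0).
by move: (tr (_ * (a * y))) (tr (_ * (a * y'))); do 8! case.
Qed.

(** Testing against (0, 1) gives Tr(ax) = Tr(bx).  Testing against all (y, 0)
    then gives (a - b)((a - b)x + e) = 0 with e = Tr(ax) + s in the prime field,
    so that e = (a - b)x has trace 0; but 1 has trace 1. *)
Lemma kerdock_polar_nondegenerate a b w : a != b ->
  (forall z, kerdock_polar a w z (+) kerdock_polar b w z = false) -> w = 0.
Proof.
case: w => [x s] ab H.
have trx : tr (a * x) = tr (b * x).
  have := H (0, 1); rewrite /kerdock_polar /= !mulr0 tr0 !andbF /=.
  by case: (tr _) (tr _) => [] [].
pose e : F := (tr (a * x) (+) (s != 0))%:R.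
have cE : (a - b) * ((a - b) * x + e) = 0.
  apply: tr_nondegenerate => y; have := H (y, 0).
  rewrite /kerdock_polar /= -trx.
  rewrite (_ : (a - b) * _ * y = a * x * (a * y) + b * x * (b * y)
                              + (e * (a * y) + e * (b * y))); last first.
    (* With a - b read as a + b, the two sides differ by twice a b x y. *)
    rewrite !(GRing.subr_pchar2 F2); have x2 := addrr_pchar2 F2 (a * b * x * y).
    rewrite -[RHS]addr0 -x2; ring.
  rewrite !trD /e; case: (tr (a * x)) (s != 0) => [] [] /=;
    rewrite ?mul1r ?mul0r ?tr0;
    by case: (tr (a * y)) (tr (b * y)) (tr (_ * (a * y))) (tr (_ * (b * y)))
      => [] [] [] [].
have xe : (a - b) * x = e.
  move/eqP: cE; rewrite mulf_eq0 subr_eq0 (negPf ab) /= addr_eq0 => /eqP ->.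
  by rewrite (oppr_pchar2 F2).
have e0 : e = 0.
  have : tr e = false.
    by rewrite -xe mulrBl (GRing.subr_pchar2 F2) trD trx addbb.
  by rewrite /e; case: (_ (+) _); rewrite // tr1.
have x0 : x = 0.
  by move/eqP: xe; rewrite e0 mulf_eq0 subr_eq0 (negPf ab) => /eqP.
have s0 : s = 0.
  apply/eqP/negPn; move/eqP: e0; rewrite /e x0 mulr0 tr0 /=.
  by case: (s != 0); rewrite // oner_eq0.
by rewrite x0 s0.
Qed.

Lemma kerdock_form0l w : kerdock_form 0 w = false.
Proof.
have := q2D 0 0; rewrite /kerdock_form !mul0r addr0 tr0 andbF addbb.
by move=> ->; rewrite andbF.
Qed.

Lemma kerdock_form0r a : kerdock_form a 0 = false.
Proof. by rewrite -(kerdock_form0l 0) /kerdock_form !mulr0. Qed.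
End Kerdock.

(** * Linking systems of maximal size *)

(** Both groups are elementary abelian 2-groups, hence determined by their
    orders. *)
Lemma additive_bij_of_exponent2 (V W : finZmodType) :
  (forall x : V, x + x = 0) -> (forall x : W, x + x = 0) -> #|V| = #|W| ->
  exists2 phi : V -> W, {morph phi : x y / x + y} & bijective phi.
Proof.
move=> V2 W2 cVW.
have ab (U : finZmodType) : (forall x : U, x + x = 0) -> (2.-abelem [set: U])%g.
  move=> U2; apply/(abelemP (isT : prime 2)); split.
    exact: FinRing.zmod_abelian.
  by move=> x _; rewrite FinRing.zmodXgE mulr2n U2.
have : ([set: V] \isog [set: W])%g.
  by rewrite (isog_abelem_card _ (ab V V2)) (ab W W2) !cardsT cVW /=.
case/isogP=> phi /injmP phi_inj _; exists phi.
  by move=> x y; apply: (morphM phi); rewrite inE.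
apply: inj_card_bij; last by rewrite cVW.
by move=> x y; apply: phi_inj; rewrite inE.
Qed.

(** The forms are indexed by the nonzero a.  Each of them is bent because its
    difference with the form of index 0, which is identically zero, is bent. *)
Lemma exists_kerdock_family d :
  exists q : 'I_(2 ^ (2 * d + 1) - 1) -> 'rV['Z_2]_(2 * d + 2) -> bool,
    [/\ forall i, q i 0 = false, forall i, bent (q i)
      & forall i j, i != j -> bent (addf (q i) (q j))].
Proof.
pose n := (2 * d + 1)%N; have n_gt0 : (0 < n)%N by rewrite /n; lia.
have [F F2 cardF] := pPrimePowerField (isT : prime 2) n_gt0.
have n_odd : odd n by rewrite /n; lia.
have [phi phiD phi_bij] :
  exists2 phi : 'rV['Z_2]_(2 * d + 2) -> kerdock_space F,
    {morph phi : x y / x + y} & bijective phi.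
  apply: additive_bij_of_exponent2 => [x|[x s]|]; first exact: addrr_Z2.
    congr pair; first by rewrite /= (addrr_pchar2 F2).
    by case: s => [[|[|s]] ?] //; apply/val_inj.
  by rewrite card_rV_Z2 card_prod cardF card_ord -expnSr -addnS.
have [psi phiK psiK] := phi_bij.
have phi0 : phi 0 = 0 by apply: (addrI (phi 0)); rewrite -phiD !addr0.
have bent_kerdock a b : a != b ->
    bent (fun x => kerdock_form n a (phi x) (+) kerdock_form n b (phi x)).
  move=> ab; apply: (@bent_polar _ _ (fun x y =>
      kerdock_polar n a (phi x) (phi y) (+) kerdock_polar n b (phi x) (phi y))).
  - move=> x y; rewrite phiD !(kerdock_formD F2 cardF) addbACA.
    by rewrite (addbACA (kerdock_form _ a _)).
  - by move=> x y z; rewrite phiD !(kerdock_polarD F2 cardF) addbACA.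
  - move=> x xB; apply: (bij_inj phi_bij); rewrite phi0.
    apply: (kerdock_polar_nondegenerate F2 cardF n_odd ab) => w.
    by rewrite -(psiK w) xB.
have cA : #|[set~ 0 : F]| = (2 ^ n - 1)%N by rewrite cardsC1 cardF subn1.
rewrite -/n -cA; exists (fun i x => kerdock_form n (enum_val i) (phi x)); split.
- by move=> i; rewrite phi0 kerdock_form0r.
- move=> i x; rewrite -(bent_kerdock (enum_val i) 0 _ x).
    by congr (_ ^+ 2); apply: eq_bigr => y _; rewrite kerdock_form0l // addbF.
  by have := enum_valP i; rewrite !inE.
- by move=> i j ij; apply: bent_kerdock; rewrite (inj_eq enum_val_inj).
Qed.

(* The group law of the finGroupType 'rV['Z_2]_m is vector addition. *)
Theorem corollary3p6 (d : nat) (hd : (1 <= d)%N) :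
  exists D : 'I_(2 ^ (2 * d + 1) - 1) -> {set 'rV['Z_2]_(2 * d + 2)},
    reduced_linking_system
      (2 ^ (2 * d + 2))
      (2 ^ d * (2 ^ (d + 1) - 1))
      (2 ^ d * (2 ^ d - 1))
      (2 ^ (2 * d))
      D.
Proof.
have [q [q0 bq bqq]] := exists_kerdock_family d.
exists (fun i => negset (q i)); apply: linking_system_of_bent => //.
have : (2 ^ 3 <= 2 ^ (2 * d + 1))%N by rewrite leq_exp2l; lia.
by lia.
Qed.
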